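(* Let $n\ge 1$, $0<\lambda<\Lambda$, $T>0$, let $\Omega\subset\mathbb{R}^n$ be open and $\Omega_T=\Omega\times(0,T)$. Let $b:\Omega_T\to\mathbb{R}^n$ and $c:\Omega_T\to\mathbb{R}$ be bounded functions with $c\le 0$, and suppose there are a number $\beta\in(0,1)$ and non-negative functions $b_0,c_0$ on $(0,T)$ such that for all $(x,t)\in\Omega_T$ $$|b(x,t)|\le b_0(t),\qquad |c(x,t)|\le c_0(t),$$ where $b_0(t)=o(t^{-1/2})$ and $c_0(t)=o(t^{1-\beta})$ as $t\to 0^+$. For $u\in C^{2,1}(\Omega_T)$ put $$\mathscr{L}u=-\frac{\partial u}{\partial t}+\mathcal{M}^+_{\lambda,\Lambda}(D^2u)+b(x,t)\cdot Du+c(x,t)u .$$ Let $E\subset\overline{\Omega}$ be a set whose Hausdorff dimension $\mathscr{H}(E)$ satisfies $$\mathscr{H}(E)<\frac{\lambda}{\Lambda},$$ and let $y_0\in E$. Let $u:\Omega_T\to\mathbb{R}$ be of class $C^{2,1}$, and suppose that for some constants $L>0$ and $\tau\in(0,\beta)$, $$u(x,t)\ge -L\quad\text{and}\quad \mathscr{L}u(x,t)\le L\,t^{-\tau}\qquad\text{for all }(x,t)\in\Omega_T .$$ If $u\ge 0$ on $\partial\Omega_T\setminus(E\times\{0\})$ near $(y_0,0)$, then $u\ge 0$ at $(y_0,0)$.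
   Context: Pucci's extremal operator: for a symmetric $n\times n$ matrix $M$ with eigenvalues $e_1,\dots,e_n$, $\mathcal{M}^+_{\lambda,\Lambda}(M)=\Lambda\sum_{e_i>0}e_i+\lambda\sum_{e_i<0}e_i$. $Du$ and $D^2u$ are the gradient and Hessian in $x$. $C^{2,1}(\Omega_T)$ means twice continuously differentiable in $x$ and once in $t$. Boundary inequalities: for a boundary point $(x_0,t_0)\in\partial\Omega_T$, ''$u\ge 0$ at $(x_0,t_0)$'' means $\liminf u(x,t)\ge 0$ as $(x,t)\to(x_0,t_0)$ from inside $\Omega_T$. For a set $\mathscr{D}\subset\partial\Omega_T$, ''$u\ge 0$ on $\mathscr{D}$'' means $u\ge0$ at every point of $\mathscr{D}$. ''$u\ge 0$ on $\mathscr{D}$ near $(y_0,0)$'' means that $u\ge 0$ on the intersection of $\mathscr{D}$ with some neighborhood of $(y_0,0)$ in $\mathbb{R}^{n+1}$. *)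

(* Defs.v *)
From HB Require Import structures.
From mathcomp Require Import all_boot all_order all_algebra.
From mathcomp Require Import spectral complex.
From mathcomp Require Import all_classical all_reals all_analysis.

Set Implicit Arguments.
Unset Strict Implicit.
Unset Printing Implicit Defensive.

Import Order.TTheory GRing.Theory Num.Theory.
Import numFieldNormedType.Exports.

Local Open Scope classical_set_scope.
Local Open Scope ring_scope.

Section EuclideanSpace.
Variables (R : realType) (n : nat).
Implicit Types (x y : 'rV[R]_n) (A E : set 'rV[R]_n).

Definition edot x y : R := \sum_(i < n) x 0 i * y 0 i.

(* The library norm `|x| on row vectors is the sup norm. *)
Definition enorm x : R := Num.sqrt (edot x x).

(* Inserting 0 in the set gives the empty set diameter 0 rather than -oo. *)
Definition ediam A : \bar R :=
  ereal_sup (0%E |` [set (enorm (x - y))%:E | x in A & y in A]).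

Definition hausdorff_premeasure (s delta : R) E : \bar R :=
  ereal_inf [set (\sum_(0 <= k <oo) ediam (F k) `^ s)%E
            | F in [set F : nat -> set 'rV[R]_n |
                    E `<=` \bigcup_k F k /\
                    forall k, (ediam (F k) <= delta%:E)%E]].

Definition hausdorff_measure (s : R) E : \bar R :=
  ereal_sup [set hausdorff_premeasure s delta E | delta in [set d | 0 < d]].

(* The restriction 0 < s avoids the convention 0 `^ 0 = 1 and does not change
   the infimum. *)
Definition hausdorff_dim E : \bar R :=
  ereal_inf [set s%:E | s in [set s | 0 < s /\ hausdorff_measure s E = 0%E]].

End EuclideanSpace.

Lemma char_poly_conj (F : fieldType) n (P A : 'M[F]_n) :
  P \in unitmx -> char_poly (invmx P *m A *m P) = char_poly A.
Proof.
move=> uP; rewrite /char_poly /char_poly_mx.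
have PP : map_mx polyC (invmx P) *m map_mx polyC P = 1%:M.
  by rewrite -map_mxM mulVmx // map_mx1.
have -> : 'X%:M - map_mx polyC (invmx P *m A *m P) =
    map_mx polyC (invmx P) *m ('X%:M - map_mx polyC A) *m map_mx polyC P.
  rewrite !map_mxM mulmxBr mulmxBl; congr (_ - _).
  by rewrite scalar_mxC -mulmxA PP mulmx1.
by rewrite !det_mulmx mulrAC -det_mulmx PP det1 mul1r.
Qed.

Lemma char_poly_sym_split (R : realType) (n : nat) (M : 'M[R]_n) : M^T = M ->
  exists s : seq R, char_poly M = \prod_(e <- s) ('X - e%:P).
Proof.
move=> symM.
pose A := map_mx (@real_complex R) M.
have hA : A \is hermsymmx.
  apply/is_hermitianmxP; rewrite expr0 scale1r.
  apply/matrixP => i j; rewrite !mxE.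
  have -> : M j i = M i j by rewrite -{1}symM mxE.
  by apply/esym/CrealP; rewrite complex_real.
have nA := hermitian_normalmx hA.
have /orthomx_spectralP AE := nA.
have /mxOverP dr := hermitian_spectral_diag_real hA.
pose d := spectral_diag A.
exists [seq complex.Re (d 0 i) | i <- enum 'I_n].
apply: (map_poly_inj (@real_complex R)).
rewrite map_char_poly -/A [in LHS]AE char_poly_conj ?spectral_unit//.
rewrite char_poly_trig ?diag_mx_is_trig// big_map rmorph_prod /= big_enum /=.
apply: eq_bigr => i _; rewrite rmorphB /= map_polyX map_polyC /= !mxE eqxx mulr1n.
by congr (_ - _%:P); move: (dr 0 i); rewrite -/d => /RRe_real.
Qed.

Section Pucci.
Variables (R : realType) (n : nat).
Implicit Type M : 'M[R]_n.

(* The eigenvalues listed with their multiplicities, in an unspecified order.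
   Only meaningful when the characteristic polynomial splits over R, as it does
   for symmetric M. *)
Definition eigenvalues M : seq R :=
  xget [::] [set s : seq R | char_poly M = \prod_(e <- s) ('X - e%:P)].

Lemma eigenvaluesP M : M^T = M ->
  char_poly M = \prod_(e <- eigenvalues M) ('X - e%:P).
Proof.
move=> /char_poly_sym_split splitM.
exact: (@xgetPex _ [::]
  [set s : seq R | char_poly M = \prod_(e <- s) ('X - e%:P)] splitM).
Qed.

Definition pucci (lam Lam : R) M : R :=
  Lam * (\sum_(e <- eigenvalues M | 0 < e) e) +
  lam * (\sum_(e <- eigenvalues M | e < 0) e).

End Pucci.

Section SpaceTime.
Variables (R : realType) (n : nat).
Local Notation V := ('rV[R]_n * R)%type.
Implicit Types (u : V -> R) (A D : set V) (p : V).

Definition cylinder (Omega : set 'rV[R]_n) (T : R) : set V :=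
  Omega `*` `]0, T[.

Definition boundary A : set V := closure A `\` interior A.

Definition xdir (i : 'I_n) : V := (delta_mx 0 i, 0).
Definition tdir : V := (0, 1).

Definition dx (i : 'I_n) u : V -> R := fun p => 'D_(xdir i) u p.
Definition dt u : V -> R := fun p => 'D_tdir u p.

Definition gradx u p : 'rV[R]_n := \row_i dx i u p.
Definition hessx u p : 'M[R]_n := \matrix_(i, j) dx j (dx i u) p.

Definition C21 A u : Prop :=
  [/\ forall p, A p -> {for p, continuous u},
      forall p, A p -> derivable u p tdir /\ {for p, continuous (dt u)},
      forall i p, A p ->
        derivable u p (xdir i) /\ {for p, continuous (dx i u)} &
      forall i j p, A p ->
        derivable (dx i u) p (xdir j) /\ {for p, continuous (dx j (dx i u))}].

Definition parabolic_op (lam Lam : R) (b : V -> 'rV[R]_n) (c : V -> R) u p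
    : R :=
  - dt u p + pucci lam Lam (hessx u p) + edot (b p) (gradx u p) + c p * u p.

Definition nonneg_at A u p : Prop :=
  (0 <= limf_einf (EFin \o u) (within A (nbhs p)))%E.

Definition nonneg_on_near A u D p : Prop :=
  \forall q \near p, D q -> nonneg_at A u q.

End SpaceTime.

(* Main.v *)
Require Import Defs.
From HB Require Import structures.
From mathcomp Require Import all_boot all_order all_algebra.
From mathcomp Require Import all_classical all_reals all_analysis.
From mathcomp Require Import ring lra.

(** Why the theorem holds.

    Pucci's maximal operator dominates lam times the trace, so wherever u is
    negative (and hence c u is nonnegative) u is a supersolution of the linear
    equation
      - du/dt + lam Laplacian(u) + b . Du <= L t^(-tau).
    Everything is therefore done for this linear operator.  The reduction
    (pucci_ge_trace) needs the Hessian to be symmetric, which is Schwarz'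
    theorem on mixed derivatives (mixed_derivatives_eq).

    Fix a coordinate i0 and choose s < lam / Lam < 1 for which E is a null set
    of the s-dimensional Hausdorff measure.  E is covered by countably many
    cubes with centres y_k and half-widths sqrt(th_k), with
    sum th_k^(s/2) <= e, and each cube is given a spreading Gaussian in the
    single variable x_i0,
      W_k(x,t) = (th_k/(t+th_k))^(s/2) exp(K t - kap (x_i0-y_k)^2/(t+th_k)),
    where kap = s/(4 lam).  Since s < 1, W_k is a supersolution as soon as K is
    large enough to absorb the bounded drift (gauss_supersolution).  It is
    bounded below by a positive constant near the k-th cube at time 0
    (gauss_ge), while at time t the sum of all W_k is at most a constant times
    e t^(-s/2) (gauss_le).

    To these are added A |x-y0|^2, which is at least L >= -u outside the
    cube of half-width r about y0, and G t^(1-tau), whose time derivative beats the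
    right-hand side and the contribution of the quadratic term.  If
    u + A |x-y0|^2 + G t^(1-tau) were negative at some point p near (y0,0), a
    small e would leave u + barrier negative at p.  Near the parabolic
    boundary u + barrier stays above a fixed negative level: off E x {0} by the
    hypothesis on u, and on E x {0} thanks to the W_k; by compactness finitely
    many k suffice (near_parabolic_boundary).  Hence u + barrier has a negative
    minimum at a point of the domain (exists_min_sublevel), where first and
    second order conditions contradict the differential inequality
    (parabolic_op_ge_at_min, no_negative_min).  So
    u >= - A |x-y0|^2 - G t^(1-tau) near (y0,0), and the right-hand side tends
    to 0 there. *)

Import Order.TTheory GRing.Theory Num.Theory.
Import numFieldNormedType.Exports.

Set Implicit Arguments.
Unset Strict Implicit.
Unset Printing Implicit Defensive.

Local Open Scope classical_set_scope.
Local Open Scope ring_scope.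

(** * Pucci's operator and the trace *)

Section PucciTrace.
Variables (R : realType) (n : nat).
Implicit Type M : 'M[R]_n.

Lemma sum_eigenvalues M : M^T = M -> \sum_(e <- eigenvalues M) e = \tr M.
Proof.
case: n M => [|m] M symM.
  have := congr1 (fun p : {poly R} => size p) (eigenvaluesP symM).
  rewrite /char_poly det_mx00 size_poly1 size_prod_XsubC => -[/esym/size0nil ->].
  by rewrite big_nil /mxtrace big_ord0.
have E := eigenvaluesP symM.
have sz : size (eigenvalues M) = m.+1.
  by move: (size_char_poly M); rewrite E size_prod_XsubC => -[].
apply: oppr_inj; rewrite -char_poly_trace// E -coefPn_prod_XsubC sz//.
Qed.

(** Each eigenvalue e contributes lam e or Lam e according to its sign, and
    either one is at least lam e. *)
Lemma pucci_ge_trace (lam Lam : R) M : lam <= Lam -> M^T = M ->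
  lam * \tr M <= pucci lam Lam M.
Proof.
move=> lL symM; rewrite -sum_eigenvalues// /pucci !mulr_sumr.
elim: (eigenvalues M) => [|e s IH]; first by rewrite !big_nil addr0.
rewrite !big_cons; case: (ltrgt0P e) => e0.
- by rewrite -addrA lerD// ler_wpM2r// ltW.
- by rewrite addrCA lerD2l.
- by rewrite e0 mulr0 add0r.
Qed.

End PucciTrace.

(** * Symmetry of mixed derivatives *)

Section MixedDerivatives.
Variables (R : realType) (V : normedModType R).
Implicit Types (f : V -> R) (v w p : V).

(** Restricting to a line does not change the difference quotients, so calculus
    of one variable applies to directional derivatives. *)
Lemma is_derive_line f p v (s d : R) :
  is_derive (s *: v + p) v f d <->
  is_derive s (1 : R) (fun h : R => f (h *: v + p)) d.
Proof.
have Q : (fun h : R => h^-1 *: ((f \o shift (s *: v + p)) (h *: v)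
           - f (s *: v + p))) =
         (fun h : R => h^-1 *: (((fun r : R => f (r *: v + p)) \o shift s) (h *: 1)
           - f (s *: v + p))).
  by apply/funext => h /=; rewrite addrA -scalerDl [h *: 1]mulr1.
split=> -[D <-]; apply: DeriveDef.
- by rewrite /derivable -Q.
- by rewrite /derive -Q.
- by rewrite /derivable Q.
- by rewrite /derive Q.
Qed.

Lemma is_derive_line0 f p v (d : R) :
  is_derive p v f d <-> is_derive (0 : R) (1 : R) (fun h : R => f (h *: v + p)) d.
Proof. by have := is_derive_line f p v 0 d; rewrite scale0r add0r. Qed.

Lemma MVT_line f p v (h : R) : 0 < h ->
    (forall s, 0 <= s <= h -> derivable f (s *: v + p) v) ->
  exists2 s, 0 < s < h & f (h *: v + p) - f p = h * 'D_v f (s *: v + p).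
Proof.
move=> h0 df; pose g (s : R) := f (s *: v + p).
have dg s : 0 <= s <= h -> is_derive s (1 : R) g ('D_v f (s *: v + p)).
  by move=> sh; apply/is_derive_line/derivableP/df.
have cg : {within `[0, h], continuous g}.
  apply: derivable_within_continuous => s; rewrite in_itv /= => sh.
  by case: (dg s sh).
have dg' s : s \in `]0, h[ -> is_derive s (1 : R) g ('D_v f (s *: v + p)).
  by rewrite in_itv /= => /andP[/ltW s0 /ltW sh]; apply: dg; rewrite s0.
have [s] := MVT h0 dg' cg.
rewrite in_itv /= => sh E; exists s => //.
by move: E; rewrite /g scale0r add0r subr0 mulrC.
Qed.

(** The second difference over a small parallelogram is symmetric in the two
    directions; two applications of the mean value theorem express it through
    a mixed derivative at a nearby point, in either order. *)
Lemma second_difference f p v w (h : R) : 0 < h ->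
    (forall a b, 0 <= a <= h -> 0 <= b <= h ->
       derivable f (a *: v + (b *: w + p)) v /\
       derivable ('D_v f) (b *: w + (a *: v + p)) w) ->
  exists2 ab : R * R, (0 < ab.1 < h) && (0 < ab.2 < h) &
    f (h *: v + (h *: w + p)) - f (h *: w + p) - (f (h *: v + p) - f p) =
    h * (h * 'D_w ('D_v f) (ab.2 *: w + (ab.1 *: v + p))).
Proof.
move=> h0 df.
have hh : 0 <= h <= h by rewrite lexx ltW.
have h00 : 0 <= (0 : R) <= h by rewrite lexx ltW.
pose g x := f (h *: w + x) - f x.
have dg s : 0 <= s <= h -> is_derive (s *: v + p) v g
    ('D_v f (h *: w + (s *: v + p)) - 'D_v f (s *: v + p)).
  move=> sh.
  have D0 : is_derive (s *: v + p) v f ('D_v f (s *: v + p)).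
    by apply: derivableP; have [+ _] := df s 0 sh h00; rewrite scale0r add0r.
  have Dh : is_derive (s *: v + p) v (fun x => f (h *: w + x))
      ('D_v f (h *: w + (s *: v + p))).
    apply/(is_derive_line (fun x => f (h *: w + x))).
    have -> : (fun r : R => f (h *: w + (r *: v + p))) =
              (fun r : R => f (r *: v + (h *: w + p))).
      by apply/funext => r; rewrite addrCA.
    rewrite addrCA; apply/(is_derive_line f); apply: derivableP.
    exact: (df s h sh hh).1.
  exact: is_deriveB.
have [s sh E] := MVT_line h0 (fun s sh => @ex_derive _ _ _ _ _ _ _ (dg s sh)).
have sh' : 0 <= s <= h by case/andP: sh => /ltW -> /ltW ->.
have [r rh E'] := @MVT_line ('D_v f) (s *: v + p) w h h0
  (fun r rh => (df s r sh' rh).2).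
exists (s, r); rewrite /= ?sh//.
rewrite -E' -(@derive_val _ _ _ _ _ _ _ (dg s sh')) -E /g.
by rewrite opprB addrACA; rewrite [h *: w + (_ + _)]addrCA; ring.
Qed.

(** Both orders of differentiation express the same second difference over a
    small parallelogram at p; continuity at p then forces equality. *)
Lemma mixed_derivatives_eq f p v w :
    (\forall q \near p, [/\ derivable f q v, derivable f q w,
       derivable ('D_v f) q w & derivable ('D_w f) q v]) ->
    {for p, continuous ('D_w ('D_v f))} -> {for p, continuous ('D_v ('D_w f))} ->
  'D_w ('D_v f) p = 'D_v ('D_w f) p.
Proof.
move=> df cvw cwv; apply/eqP; rewrite -subr_eq0 -normr_le0.
apply/ler_addgt0Pl => e e0; rewrite addr0.
have e2 : 0 < e / 2 by rewrite divr_gt0.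
have cvw' : \forall q \near p, `|'D_w ('D_v f) p - 'D_w ('D_v f) q| < e / 2.
  by move/cvgrPdist_lt : cvw; apply.
have cwv' : \forall q \near p, `|'D_v ('D_w f) p - 'D_v ('D_w f) q| < e / 2.
  by move/cvgrPdist_lt : cwv; apply.
have near_p : \forall q \near p, [/\ derivable f q v, derivable f q w,
       derivable ('D_v f) q w & derivable ('D_w f) q v] /\
    (`|'D_w ('D_v f) p - 'D_w ('D_v f) q| < e / 2 /\
     `|'D_v ('D_w f) p - 'D_v ('D_w f) q| < e / 2).
  by apply: filterS3 df cvw' cwv' => q.
have {near_p} [r /= r0 near_p] := (nbhs_ballP p _).1 near_p.
pose h := r / 2 / (`|v| + `|w| + 1).
have h0 : 0 < h by rewrite !divr_gt0// ltr_wpDl// addr_ge0.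
have in_ball a b : 0 <= a <= h -> 0 <= b <= h ->
    ball p r (a *: v + (b *: w + p)).
  move=> /andP[a0 ah] /andP[b0 bh]; rewrite -ball_normE /= distrC addrA addrK.
  rewrite (le_lt_trans (ler_normD _ _))// !normrZ !ger0_norm//.
  have : h * (`|v| + `|w| + 1) = r / 2.
    by rewrite /h divfK// gt_eqF// ltr_wpDl// addr_ge0.
  have := normr_ge0 v; have := normr_ge0 w; nra.
have [[a b] /= /andP[/andP[/ltW a0 /ltW ah] /andP[/ltW b0 /ltW bh]]] :=
    @second_difference f p v w h h0 (fun a b ha hb =>
      let: And4 dv _ dvw _ := (near_p _ (in_ball a b ha hb)).1 in conj dv
        (eq_ind _ (fun x => derivable ('D_v f) x w) dvw _ (addrCA _ _ _))).
have [[b' a'] /= /andP[/andP[/ltW b0' /ltW bh'] /andP[/ltW a0' /ltW ah']]] :=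
    @second_difference f p w v h h0 (fun b a hb ha =>
      let: And4 _ dw _ dwv := (near_p _ (in_ball a b ha hb)).1 in conj
        (eq_ind _ (fun x => derivable f x w) dw _ (addrCA _ _ _)) dwv).
rewrite [h *: w + (h *: v + p)]addrCA => E' E.
have swap (k l m o : R) : k - l - (m - o) = k - m - (l - o) by ring.
have {E E'} : 'D_w ('D_v f) (a *: v + (b *: w + p)) =
              'D_v ('D_w f) (a' *: v + (b' *: w + p)).
  rewrite addrCA; apply: (mulfI (lt0r_neq0 h0)); apply: (mulfI (lt0r_neq0 h0)).
  exact: (etrans (esym E) (etrans (swap _ _ _ _) E')).
have ab : ball p r (a *: v + (b *: w + p)) by apply: in_ball; apply/andP.
have ab' : ball p r (a' *: v + (b' *: w + p)) by apply: in_ball; apply/andP.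
have [_ [+ _]] := near_p _ ab; have [_ [_ +]] := near_p _ ab'.
have triangle (x y z z' : R) : `|y - z'| < e / 2 -> `|x - z| < e / 2 -> z = z' ->
    `|x - y| <= e.
  move=> + + zz; rewrite -zz => /ltr_normlP[? ?] /ltr_normlP[? ?].
  by apply/ler_normlP; split; lra.
exact: triangle.
Qed.

End MixedDerivatives.

(** * Derivative tests at a minimum on the line *)

Section DerivativeTests.
Variable R : realType.
Implicit Type f : R -> R.

Lemma is_derive_sign_quotient f d : is_derive (0 : R) (1 : R) f d -> 0 < d ->
  \forall h \near (0 : R), h != 0 -> 0 < h^-1 * (f h - f 0).
Proof.
move=> [df dE] d0.
have : h^-1 *: ((f \o shift 0) (h *: 1) - f 0) @[h --> (0 : R)^'] --> d.
  by rewrite -dE.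
move/cvgr_gt => /(_ 0 d0); rewrite near_withinE.
by apply: filterS => h /= + h0 => /(_ h0); rewrite addr0 [h%:A]mulr1.
Qed.

(** One-sided, because at the final time of the domain only earlier times are
    available for comparison. *)
Lemma derive_le0_left_min f d : is_derive (0 : R) (1 : R) f d ->
  (\forall h \near (0 : R), h <= 0 -> f 0 <= f h) -> d <= 0.
Proof.
move=> df fmin; rewrite leNgt; apply/negP => d0.
have : \forall h \near (0 : R), h < 0 -> False.
  apply: filterS2 (is_derive_sign_quotient df d0) fmin => h q m h0.
  have := q (ltr0_neq0 h0); rewrite nmulr_rgt0 ?invr_lt0//.
  by rewrite subr_lt0 ltNge m// ltW.
move=> /nbhs_normP[r /= r0 /(_ (- (r / 2)))]; apply.
  by rewrite /= sub0r opprK gtr0_norm ?divr_gt0// ltr_pdivrMr//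
    mulr_natr mulr2n ltrDl.
by rewrite oppr_lt0 divr_gt0.
Qed.

Lemma derive_eq0_min f d : is_derive (0 : R) (1 : R) f d ->
  (\forall h \near (0 : R), f 0 <= f h) -> d = 0.
Proof.
move=> df fmin; apply/eqP; rewrite eq_le; apply/andP; split.
  by apply: derive_le0_left_min df _; apply: filterS fmin.
rewrite -oppr_le0; apply: (@derive_le0_left_min (fun h => f (- h))).
  have <- : d * (-1) = - d by rewrite mulrN1.
  apply: is_derive1_comp; rewrite ?oppr0//.
rewrite oppr0; move/nbhs_normP : fmin => [r /= r0 fmin].
apply/nbhs_normP; exists r => //= h; rewrite /= sub0r normrN => hr _.
by apply: fmin; rewrite /= sub0r opprK.
Qed.

(** If the second derivative were negative, f' would be negative just to the
    right of 0, and by the mean value theorem f would drop below f 0. *)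
Lemma second_derive_ge0_min f f' d :
    (\forall h \near (0 : R), is_derive h (1 : R) f (f' h)) ->
    is_derive (0 : R) (1 : R) f' d ->
    (\forall h \near (0 : R), f 0 <= f h) ->
  f' 0 = 0 /\ 0 <= d.
Proof.
move=> df df' fmin.
have f'0 : f' 0 = 0 by apply: derive_eq0_min fmin; exact: nbhs_singleton df.
split=> //; rewrite leNgt; apply/negP => d0.
have nd0 : 0 < - d by rewrite oppr_gt0.
have : \forall h \near (0 : R), h != 0 -> 0 < h^-1 * (- f' h - - f' 0).
  exact: (@is_derive_sign_quotient (fun h => - f' h)).
move=> sgn; have : \forall h \near (0 : R), [/\ is_derive h (1 : R) f (f' h),
    f 0 <= f h & h != 0 -> 0 < h^-1 * (- f' h - - f' 0)].
  by apply: filterS3 df fmin sgn => h.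
move=> /nbhs_normP[r /= r0 near0].
have in_r h : 0 <= h <= r / 2 -> `|0 - h| < r.
  move=> /andP[h0 hr]; rewrite sub0r normrN ger0_norm//; lra.
have r2 : 0 < r / 2 by rewrite divr_gt0.
have [||c] := @MVT _ f f' 0 (r / 2) r2.
- move=> x; rewrite in_itv /= => /andP[/ltW x0 /ltW xr].
  by have [] := near0 x (in_r x _); rewrite ?x0.
- apply: derivable_within_continuous => x; rewrite in_itv /= => xr.
  by have [[]] := near0 x (in_r x xr).
rewrite in_itv /= => /andP[c0 cr].
have cr' : 0 <= c <= r / 2 by rewrite !ltW.
have [_ _] := near0 c (in_r c cr'); rewrite f'0 opprK addr0 gt_eqF// => /(_ isT).
rewrite pmulr_rgt0 ?invr_gt0// oppr_gt0 subr0 => fc E.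
have rr : 0 <= r / 2 <= r / 2 by rewrite lexx ltW.
have [_ + _] := near0 (r / 2) (in_r _ rr).
by rewrite -subr_ge0 E leNgt nmulr_rlt0// r2.
Qed.

End DerivativeTests.

(** * The operator at a minimum of u plus a separable function *)

Section TouchingFromBelow.
Variables (R : realType) (n : nat).
Local Notation V := ('rV[R]_n * R)%type.
Implicit Types (A : set V) (u : V -> R) (p q : V).

Lemma near_line (W : normedModType R) (v x : W) (P : set W) :
  (\forall y \near x, P y) -> \forall h \near (0 : R), P (h *: v + x).
Proof.
move=> Px; have : h *: v + x @[h --> (0 : R)] --> x.
  rewrite -[X in _ --> X]add0r -[X in _ --> X + _](scale0r v).
  by apply: cvgD; [apply: cvgZr_tmp; exact: cvg_id|exact: cvg_cst].
by apply.
Qed.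

Lemma hessx_sym A u p : open A -> C21 A u -> A p -> (hessx u p)^T = hessx u p.
Proof.
move=> oA [_ _ d1 d2] Ap; apply/matrixP => i j; rewrite !mxE.
apply: mixed_derivatives_eq; last 2 first.
- by have [] := d2 j i p Ap.
- by have [] := d2 i j p Ap.
have /= Ap' : \forall q \near p, A q by exact: oA.
apply: filterS Ap' => q Aq; split.
- by have [] := d1 j q Aq.
- by have [] := d1 i q Aq.
- by have [] := d2 j i q Aq.
- by have [] := d2 i j q Aq.
Qed.

(** Barriers are sums over the coordinates of functions of that coordinate and
    of time, so that all their derivatives are those of functions of one
    variable and no mixed derivative appears. *)
Definition separable_sum (g : 'I_n -> R -> R -> R) : V -> R :=
  fun p => \sum_(i < n) g i (p.1 0 i) p.2.

Lemma separable_sum_line g p (i : 'I_n) (h : R) :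
  separable_sum g (h *: xdir R i + p) - separable_sum g p =
  g i (h + p.1 0 i) p.2 - g i (p.1 0 i) p.2.
Proof.
rewrite /separable_sum -sumrB (bigD1 i)//= big1 ?addr0 => [|j ji].
  by rewrite !mxE !eqxx mulr1 scaler0 add0r.
by rewrite !mxE eqxx (negPf ji) /= mulr0 add0r scaler0 add0r subrr.
Qed.

(** At a minimum over earlier times, the time derivative of u + sum_i g_i is
    nonpositive, its gradient vanishes and its pure second derivatives are
    nonnegative; only the diagonal of the Hessian matters because Pucci's
    operator has been bounded below by lam times the trace. *)
Lemma parabolic_op_ge_at_min A (lam Lam : R) (b : V -> 'rV[R]_n) (c : V -> R) u p
    (g gx gxx gt : 'I_n -> R -> R -> R) :
    open A -> C21 A u -> A p -> 0 <= lam <= Lam -> 0 <= c p * u p ->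
    (forall i x, is_derive x (1 : R) (g i ^~ p.2) (gx i x p.2)) ->
    (forall i x, is_derive x (1 : R) (gx i ^~ p.2) (gxx i x p.2)) ->
    (forall i x, is_derive p.2 (1 : R) (g i x) (gt i x p.2)) ->
    (\forall q \near p, q.2 <= p.2 ->
       u p + separable_sum g p <= u q + separable_sum g q) ->
  \sum_(i < n) (gt i (p.1 0 i) p.2 - lam * gxx i (p.1 0 i) p.2
                - b p 0 i * gx i (p.1 0 i) p.2)
    <= parabolic_op lam Lam b c u p.
Proof.
move=> oA uA Ap /andP[lam0 lL] cu dgx dgxx dgt umin.
have [_ ut ux uxx] := uA.
have Ap' : \forall q \near p, A q by exact: oA.
have shift_le (k k' l l' m m' : R) :
    k + l <= k' + l' -> l' - l = m' - m -> k + m <= k' + m' by move=> *; lra.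
have time : dt u p + \sum_(i < n) gt i (p.1 0 i) p.2 <= 0.
  pose f h := u (h *: tdir R n + p) + separable_sum g (h *: tdir R n + p).
  apply: (@derive_le0_left_min R f); last first.
    have := near_line (tdir R n) umin; apply: filterS => h + h0.
    by rewrite /f scale0r add0r; apply; rewrite /= [_%:A]mulr1 gerDr.
  apply: is_deriveD.
    exact: ((is_derive_line0 u p _ _).1 (derivableP (ut p Ap).1)).
  have -> : (fun h : R => separable_sum g (h *: tdir R n + p)) =
            \sum_(i < n) (fun h : R => g i (p.1 0 i) (h *: 1 + p.2)).
    apply/funext => h; rewrite /separable_sum fct_sumE.
    by apply: eq_bigr => i _; rewrite /= scaler0 add0r.
  by apply: is_derive_sum => i; apply/(is_derive_line0 (g i (p.1 0 i))).
have space i : dx i u p + gx i (p.1 0 i) p.2 = 0 /\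
    0 <= hessx u p i i + gxx i (p.1 0 i) p.2.
  pose f h := u (h *: xdir R i + p) + g i (h *: 1 + p.1 0 i) p.2.
  pose f' h := dx i u (h *: xdir R i + p) + gx i (h *: 1 + p.1 0 i) p.2.
  have /(_ _ _ _)[|||] := @second_derive_ge0_min R f f'
    (hessx u p i i + gxx i (p.1 0 i) p.2).
  - have := near_line (xdir R i) Ap'; apply: filterS => h Ah.
    apply: is_deriveD.
      exact: ((is_derive_line u p _ h _).1 (derivableP (ux i _ Ah).1)).
    exact: ((is_derive_line (g i ^~ p.2) (p.1 0 i) 1 h _).1 (dgx i _)).
  - apply: is_deriveD.
      rewrite mxE.
      exact: ((is_derive_line0 (dx i u) p _ _).1 (derivableP (uxx i i p Ap).1)).
    exact: ((is_derive_line0 (gx i ^~ p.2) (p.1 0 i) 1 _).1 (dgxx i _)).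
  - have := near_line (xdir R i) umin; apply: filterS => h.
    have -> : (h *: xdir R i + p).2 = p.2 by rewrite /= scaler0 add0r.
    move=> /(_ (lexx _)) umin_h; rewrite /f !scale0r !add0r [h *: 1]mulr1.
    exact: shift_le umin_h (separable_sum_line g p i h).
  by rewrite /f' !scale0r !add0r.
have hess : - \sum_(i < n) gxx i (p.1 0 i) p.2 <= \tr (hessx u p).
  rewrite /mxtrace -sumrN; apply: ler_sum => i _.
  by have [_] := space i; lra.
have puc := pucci_ge_trace lL (hessx_sym oA uA Ap).
have drift : edot (b p) (gradx u p) = - \sum_(i < n) b p 0 i * gx i (p.1 0 i) p.2.
  rewrite /edot -sumrN; apply: eq_bigr => i _; rewrite mxE.
  by have [/eqP + _] := space i; rewrite addr_eq0 => /eqP ->; rewrite mulrN.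
rewrite /parabolic_op drift !sumrB -mulr_sumr.
have := le_trans (ler_wpM2l lam0 hess) puc; rewrite mulrN.
have combine (d g2 k1 k2 k3 k4 : R) : d + k1 <= 0 -> 0 <= k4 -> - k2 <= g2 ->
    k1 - k2 - k3 <= - d + g2 + - k3 + k4 by move=> *; lra.
exact: combine.
Qed.

End TouchingFromBelow.

(** * The Gaussian supersolution in one space variable *)

Section GaussianBarrier.
Variables (R : realType) (a kap K th y : R).
Implicit Types x t : R.

(** gauss is (th / (t + th))^a exp(K t - kap (x - y)^2 / (t + th)), written as
    an exponential so that its derivatives are the product of gauss with
    those of gauss_log. *)
Definition gauss_log x t : R :=
  a * ln th + K * t - a * ln (t + th) - kap * (x - y) ^+ 2 / (t + th).
Definition gauss x t : R := expR (gauss_log x t).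
Definition gauss_x x t : R := gauss x t * (- (2 * kap * (x - y) / (t + th))).
Definition gauss_xx x t : R :=
  gauss x t * (4 * kap ^+ 2 * ((x - y) / (t + th)) ^+ 2 - 2 * kap / (t + th)).
Definition gauss_t x t : R :=
  gauss x t * (K - a / (t + th) + kap * ((x - y) / (t + th)) ^+ 2).

Lemma is_derive_gauss_x x t :
  is_derive x (1 : R) (gauss ^~ t) (gauss_x x t).
Proof.
have D : is_derive x (1 : R) (gauss_log ^~ t) (- (2 * kap * (x - y) / (t + th))).
  rewrite /gauss_log.
  apply: is_derive_eq.
  rewrite ?scaler0 ?addr0 /GRing.scale /=; ring.
exact: is_derive1_comp.
Qed.

Lemma is_derive_gauss_xx x t :
  is_derive x (1 : R) (gauss_x ^~ t) (gauss_xx x t).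
Proof.
have D := is_derive_gauss_x x t.
rewrite /gauss_x.
have L : is_derive x (1 : R) (fun x => - (2 * kap * (x - y) / (t + th)))
    (- (2 * kap / (t + th))).
  apply: is_derive_eq; rewrite ?scaler0 ?addr0 /GRing.scale /=; ring.
apply: (is_derive_eq (is_deriveM D L)).
rewrite /gauss_x /gauss_xx /GRing.scale /=; ring.
Qed.

Lemma is_derive_gauss_t x t : 0 < t + th ->
  is_derive t (1 : R) (gauss x) (gauss_t x t).
Proof.
move=> t0.
have D0 : is_derive t (1 : R) (fun t => t + th) 1.
  apply: is_derive_eq; rewrite addr0//.
have D1 : is_derive t (1 : R) (fun t => ln (t + th)) ((t + th)^-1 * 1).
  by apply: (@is_derive1_comp _ (@ln R) (fun t => t + th)); exact: is_derive1_ln.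
have D2 : is_derive t (1 : R) (fun t => (t + th)^-1) (- (t + th) ^- 2 *: 1).
  by apply: is_deriveV; rewrite ?gt_eqF.
have D : is_derive t (1 : R) (gauss_log x)
    (K - a / (t + th) + kap * ((x - y) / (t + th)) ^+ 2).
  rewrite /gauss_log.
  apply: is_derive_eq.
  rewrite ?scaler0 ?addr0 /GRing.scale /=; field.
  by rewrite gt_eqF.
exact: is_derive1_comp.
Qed.

(** The factor exp(a ln th) is the weight of the k-th cube in the sum bounding
    the size of the cover; for fixed t > 0 the other factor is a constant. *)
Lemma gauss_le x t : 0 <= a -> 0 <= kap -> 0 <= K -> 0 < th -> 0 < t <= 1 ->
  gauss x t <= expR (a * ln th) * expR (K - a * ln t).
Proof.
move=> a0 kap0 K0 th0 /andP[t0 t1]; rewrite -expRD ler_expR /gauss_log.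
have : a * ln t <= a * ln (t + th) by rewrite ler_wpM2l// ler_ln ?posrE//; lra.
have : 0 <= kap * (x - y) ^+ 2 / (t + th).
  by apply: divr_ge0; [apply: mulr_ge0 => //; exact: sqr_ge0|lra].
nra.
Qed.

(** The thresholds t <= th and (x - y)^2 <= 4 th hold on a neighbourhood of the
    cube (x - y)^2 <= th at time 0, and the bound does not depend on th. *)
Lemma gauss_ge x t : 0 <= a -> 0 <= kap -> 0 <= K -> 0 < th -> 0 <= t <= th ->
  (x - y) ^+ 2 <= 4 * th -> expR (- (a * ln 2 + 4 * kap)) <= gauss x t.
Proof.
move=> a0 kap0 K0 th0 /andP[t0 tt] xy; rewrite ler_expR /gauss_log.
have : a * ln (t + th) <= a * (ln 2 + ln th).
  by rewrite ler_wpM2l// -lnM ?posrE// ler_ln ?posrE; lra.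
have : kap * (x - y) ^+ 2 / (t + th) <= 4 * kap.
  by rewrite ler_pdivrMr; nra.
nra.
Qed.

End GaussianBarrier.

(** With a = s / 2 and kap = s / (4 lam) the terms of order 1 / (t + th) cancel.
    Writing z = (x - y) / (t + th), what remains is
      K + kap (1 - s) z^2 + 2 kap b z,
    which for this K and |b| <= B is nonnegative by completing the square; this
    is where s < 1 is used. *)
Lemma gauss_supersolution (R : realType) (lam s B th y b x t : R) :
  0 < lam -> 0 < s < 1 -> `|b| <= B ->
  let kap := s / (4 * lam) in let K := kap * B ^+ 2 / (1 - s) in
  0 <= gauss_t (s / 2) kap K th y x t
       - lam * gauss_xx (s / 2) kap K th y x t
       - b * gauss_x (s / 2) kap K th y x t.
Proof.
move=> lam0 /andP[s0 s1] bB /=; rewrite /gauss_t /gauss_xx /gauss_x.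
set kap := s / (4 * lam); set K := kap * B ^+ 2 / (1 - s).
set w := gauss _ _ _ _ _ _ _; set z := (x - y) / (t + th).
have s1' : 0 < 1 - s by lra.
have kap0 : 0 < kap by rewrite divr_gt0// mulr_gt0.
have lk : 4 * lam * kap = s by rewrite /kap; field; rewrite gt_eqF.
have -> : w * (K - s / 2 / (t + th) + kap * z ^+ 2)
    - lam * (w * (4 * kap ^+ 2 * z ^+ 2 - 2 * kap / (t + th)))
    - b * (w * - (2 * kap * (x - y) / (t + th))) =
  w * (kap / (1 - s)) * (((1 - s) * z + b) ^+ 2 + (B ^+ 2 - b ^+ 2)).
  have -> : 2 * kap * (x - y) / (t + th) = 2 * kap * z by rewrite /z; ring.
  have -> : lam = s / (4 * kap) by rewrite -lk; field; rewrite gt_eqF.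
  rewrite /K; move: (t + th)^-1 => c; field.
  by rewrite !gt_eqF.
have b2 : b ^+ 2 <= B ^+ 2.
  by move: bB => /ler_normlP[? ?]; nra.
apply: mulr_ge0; last by rewrite addr_ge0 ?sqr_ge0// subr_ge0.
by rewrite mulr_ge0 ?expR_ge0// divr_ge0// ltW.
Qed.

(** * Covers of sets of small Hausdorff dimension *)

Section HausdorffCovers.
Variables (R : realType) (n : nat).
Implicit Types (E F : set 'rV[R]_n) (x y : 'rV[R]_n) (s : R).

Lemma hausdorff_dim_lt E (d : R) : (hausdorff_dim E < d%:E)%E ->
  exists s, 0 < s < d /\ hausdorff_measure s E = 0%E.
Proof.
move=> /ereal_inf_lt[_ /= [s [s0 Es] <-]]; rewrite lte_fin => sd.
by exists s; rewrite s0.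
Qed.

Lemma hausdorff_measure0_cover E s (e : R) : hausdorff_measure s E = 0%E -> 0 < e ->
  exists F : nat -> set 'rV[R]_n, [/\ E `<=` \bigcup_k F k,
    forall k, (ediam (F k) <= 1)%E &
    (\sum_(0 <= k <oo) ediam (F k) `^ s < e%:E)%E].
Proof.
move=> Es e0; have : (hausdorff_premeasure s 1 E < e%:E)%E.
  apply: (@le_lt_trans _ _ 0%E); last by rewrite lte_fin.
  by rewrite -Es; apply: ereal_sup_ubound; exists 1 => //=.
by move=> /ereal_inf_lt[_ /= [F [EF F1] <-] Fe]; exists F.
Qed.

Lemma ediam_ge0 F : (0 <= ediam F)%E.
Proof. by apply: ereal_sup_ubound; left. Qed.

Lemma sqr_coord_le_enorm x (i : 'I_n) : x 0 i ^+ 2 <= enorm x ^+ 2.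
Proof.
have xx : 0 <= edot x x by apply: sumr_ge0 => j _; rewrite -expr2 sqr_ge0.
rewrite sqr_sqrtr// /edot (bigD1 i)//= -expr2 lerDl.
by apply: sumr_ge0 => j _; rewrite -expr2 sqr_ge0.
Qed.

Lemma sum_halves_le (e : R) (N : nat) : 0 <= e ->
  \sum_(k < N) e / 2 ^+ k.+1 <= e.
Proof.
move=> e0; suff -> : \sum_(k < N) e / 2 ^+ k.+1 = e - e / 2 ^+ N.
  by rewrite gerBl divr_ge0// exprn_ge0.
elim: N => [|N IH]; first by rewrite big_ord0 expr0 divr1 subrr.
rewrite big_ord_recr /= IH exprS; field.
by rewrite expf_neq0.
Qed.

(** A covering set of diameter d lies in the cube of half-width d about any of
    its points; the term e / 2 ^ (k + 2) added to d ^ s keeps th k positive even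
    where the covering set is a single point. *)
Lemma hausdorff_measure0_cubes E s (e : R) :
    0 < s -> hausdorff_measure s E = 0%E -> 0 < e ->
  exists (y : nat -> 'rV[R]_n) (th : nat -> R), [/\ forall k, 0 < th k,
    forall N, \sum_(k < N) th k `^ (s / 2) <= e &
    forall x, E x -> exists k, forall i, (x 0 i - y k 0 i) ^+ 2 <= th k].
Proof.
move=> s0 Es e0; have e2 : 0 < e / 2 by rewrite divr_gt0.
have [F [EF F1 Fe]] := hausdorff_measure0_cover Es e2.
pose d k := fine (ediam (F k)).
have dE k : ediam (F k) = (d k)%:E.
  by rewrite fineK// ge0_fin_numE ?ediam_ge0// (le_lt_trans (F1 k)) ?ltry.
have d0 k : 0 <= d k by rewrite -lee_fin -dE ediam_ge0.
pose m k := d k `^ s + e / 2 / 2 ^+ k.+1.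
have m0 k : 0 < m k.
  by rewrite ltr_wpDl ?powR_ge0// divr_gt0// exprn_gt0.
exists (fun k => xget 0 (F k)), (fun k => m k `^ (2 / s)); split.
- by move=> k; rewrite powR_gt0.
- move=> N; under eq_bigr => k _.
    rewrite -powRrM (_ : 2 / s * (s / 2) = 1); last by field; rewrite gt_eqF.
    rewrite powRr1 ?ltW//; over.
  rewrite big_split /= [leRHS](splitr e); apply: lerD; last first.
    by apply: sum_halves_le; exact: ltW.
  rewrite -lee_fin -sumEFin; apply: le_trans (ltW Fe).
  rewrite (nneseries_split 0 N); last by move=> k _; exact: poweR_ge0.
  rewrite add0n big_mkord; under [X in (_ <= X + _)%E]eq_bigr do rewrite dE poweR_EFin.
  by rewrite leeDl// nneseries_ge0// => k _ _; exact: poweR_ge0.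
- move=> x /EF[k _ Fx]; exists k => i.
  have Fy : F k (xget 0 (F k)) by exact: (xgetPex 0 (ex_intro _ x Fx)).
  have := sqr_coord_le_enorm (x - xget 0 (F k)) i; rewrite !mxE => /le_trans; apply.
  have xyd : enorm (x - xget 0 (F k)) <= d k.
    rewrite -lee_fin -dE; apply: ereal_sup_ubound; right.
    by exists x => //; exists (xget 0 (F k)).
  apply: (@le_trans _ _ (d k ^+ 2)).
    by rewrite lerXn2r ?nnegrE ?sqrtr_ge0.
  have -> : d k ^+ 2 = (d k `^ s) `^ (2 / s).
    rewrite -powRrM mulrCA divff ?gt_eqF// mulr1.
    by rewrite -powR_mulrn.
  have dm : d k `^ s <= m k by rewrite lerDl ltW// divr_gt0// exprn_gt0.
  by apply: ge0_ler_powR dm; rewrite ?nnegrE ?powR_ge0//; apply: ltW;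
    rewrite ?m0 ?divr_gt0.
Qed.

End HausdorffCovers.

(** * Boundary values *)

Lemma nonneg_atP (R : realType) (n : nat) (A : set ('rV[R]_n * R))
    (u : 'rV[R]_n * R -> R) p :
  nonneg_at A u p <->
  forall e, 0 < e -> \forall q \near p, A q -> - e < u q.
Proof.
rewrite /nonneg_at limf_einfE; split=> [u0 e e0|u0].
  have : ((- e)%:E < ereal_sup [set ereal_inf ((EFin \o u) @` V)
                               | V in within A (nbhs p)])%E.
    by apply: lt_le_trans u0; rewrite lte_fin oppr_lt0.
  move=> /ereal_sup_gt[_ [V /= AV <-] eV].
  have {}AV : \forall q \near p, A q -> V q := AV.
  apply: filterS AV => q Vq Aq; rewrite -lte_fin; apply: lt_le_trans eV _.
  by apply: ereal_inf_lbound; exists q => //; exact: Vq.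
apply/lee_subgt0Pr => e e0; rewrite sub0e.
apply: le_ereal_sup_tmp; exists (ereal_inf ((EFin \o u) @` [set q | - e < u q])).
  by exists [set q | - e < u q] => //; exact: u0.
by apply: le_ereal_inf_tmp => _ [q /= eq <-]; rewrite lee_fin ltW.
Qed.

(** * Existence of an interior minimum *)

Section MinimumPrinciple.
Variables (R : realType) (X : topologicalType).

(** An interior minimum exists as soon as v stays above the level m near the
    part of the compact set K that lies outside the open set A, because the
    sublevel set of m in A is then compact. *)
Lemma exists_min_sublevel (A K : set X) (v : X -> R) (m : R) (p0 : X) :
    open A -> closed K -> compact K ->
    (forall q, A q -> {for q, continuous v}) ->
    (forall q, K q -> ~ A q -> \forall q' \near q, A q' -> m < v q') ->
    A p0 -> K p0 -> v p0 <= m ->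
  exists p, [/\ A p, K p, v p <= m & forall q, A q -> K q -> v p <= v q].
Proof.
move=> oA clK cK vcont vK Ap0 Kp0 vp0.
pose S := [set q | [/\ A q, K q & v q <= m]].
have cS : compact S.
  apply: (subclosed_compact _ cK) => [q Sq|q []//].
  have Kq : K q by apply: clK => U /Sq[q' [[_ Kq' _] Uq']]; exists q'.
  have Aq : A q.
    apply: contrapT => nAq; have [q' [[Aq' _ vq'] ]] := Sq _ (vK q Kq nAq).
    by move=> /(_ Aq'); rewrite ltNge vq'.
  split=> //; rewrite leNgt; apply/negP => mv.
  have /Sq[q' [[_ _ vq']] /=] : \forall q' \near q, m < v q'.
    exact: (cvgr_gt _ (vcont q Aq)).
  by rewrite ltNge vq'.
have [|p] := compact_EVT_min (ex_intro _ p0 (And3 Ap0 Kp0 vp0)) cS (f := v).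
  by apply: continuous_in_subspaceT => q /set_mem[Aq _ _]; exact: vcont.
rewrite inE => -[Ap Kp vp] pmin; exists p; split=> // q Aq Kq.
have [vq|/ltW/(le_trans vp)//] := leP (v q) m.
by apply: pmin; rewrite inE.
Qed.

End MinimumPrinciple.

(** * The barrier *)

Section Barrier.
Variables (R : realType) (n : nat) (i0 : 'I_n).
Variables (a kap K A G tau C : R) (y0 : 'rV[R]_n).
Variables (y : nat -> R) (th : nat -> R) (N : nat).
Local Notation V := ('rV[R]_n * R)%type.

(** The singular part is carried by the coordinate i0 alone: the projection of
    E on a line is still negligible for the s-dimensional measure, and s < 1
    is exactly what a Gaussian in one variable can absorb. *)
Definition singular_part (x t : R) : R :=
  G * t `^ (1 - tau) + C * \sum_(k < N) gauss a kap K (th k) (y k) x t.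
Definition singular_part_x (x t : R) : R :=
  C * \sum_(k < N) gauss_x a kap K (th k) (y k) x t.
Definition singular_part_xx (x t : R) : R :=
  C * \sum_(k < N) gauss_xx a kap K (th k) (y k) x t.
Definition singular_part_t (x t : R) : R :=
  G * ((1 - tau) * t `^ (- tau)) +
  C * \sum_(k < N) gauss_t a kap K (th k) (y k) x t.

Definition profile (i : 'I_n) (x t : R) : R :=
  A * (x - y0 0 i) ^+ 2 + (if i == i0 then singular_part x t else 0).
Definition profile_x (i : 'I_n) (x t : R) : R :=
  A * (2 * (x - y0 0 i)) + (if i == i0 then singular_part_x x t else 0).
Definition profile_xx (i : 'I_n) (x t : R) : R :=
  A * 2 + (if i == i0 then singular_part_xx x t else 0).
Definition profile_t (i : 'I_n) (x t : R) : R :=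
  if i == i0 then singular_part_t x t else 0.

Definition barrier : V -> R := separable_sum profile.

Lemma is_derive_sum_fun m (f : 'I_m -> R -> R) (df : 'I_m -> R) (x : R) :
  (forall k, is_derive x (1 : R) (f k) (df k)) ->
  is_derive x (1 : R) (fun x => \sum_(k < m) f k x) (\sum_(k < m) df k).
Proof.
move=> fdf; have -> : (fun x => \sum_(k < m) f k x) = \sum_(k < m) f k.
  by apply/funext => z; rewrite fct_sumE.
exact: is_derive_sum.
Qed.

Lemma is_derive_profile_x i x t :
  is_derive x (1 : R) (profile i ^~ t) (profile_x i x t).
Proof.
have D0 : is_derive x (1 : R) (fun x => A * (x - y0 0 i) ^+ 2) (A * (2 * (x - y0 0 i))).
  by apply: is_derive_eq; rewrite ?scaler0 ?addr0 /GRing.scale /=; ring.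
apply: is_deriveD; case: eqP => _; last exact: is_derive_cst.
rewrite /singular_part_x -[X in is_derive _ _ _ X]add0r.
apply: is_deriveD; apply: is_deriveZ; apply: is_derive_sum_fun => k; exact: is_derive_gauss_x.
Qed.

Lemma is_derive_profile_xx i x t :
  is_derive x (1 : R) (profile_x i ^~ t) (profile_xx i x t).
Proof.
have D0 : is_derive x (1 : R) (fun x => A * (2 * (x - y0 0 i))) (A * 2).
  by apply: is_derive_eq; rewrite ?scaler0 ?addr0 /GRing.scale /=; ring.
apply: is_deriveD; case: eqP => _; last exact: is_derive_cst.
apply: is_deriveZ; apply: is_derive_sum_fun => k; exact: is_derive_gauss_xx.
Qed.

Lemma is_derive_profile_t i (x t : R) : 0 < t -> (forall k, 0 < th k) ->
  is_derive t (1 : R) (profile i x) (profile_t i x t).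
Proof.
move=> t0 th0; rewrite -[profile_t _ _ _]add0r.
apply: is_deriveD; rewrite /profile_t; case: eqP => _; last exact: is_derive_cst.
apply: is_deriveD; apply: is_deriveZ.
  have := is_derive1_powR (1 - tau) t0.
  by rewrite (_ : 1 - tau - 1 = - tau)//; ring.
by apply: is_derive_sum_fun => k; apply: is_derive_gauss_t; rewrite addr_gt0.
Qed.

Lemma continuous_fst_coord (i : 'I_n) : continuous (fun q : V => q.1 0 i).
Proof.
move=> p; apply: (@cvg_comp _ _ _ (fun q : V => q.1) (fun M : 'rV[R]_n => M 0 i)).
  exact: cvg_fst.
exact: coord_continuous.
Qed.

Lemma continuous_gauss b kp kk h z (i : 'I_n) (p : V) : 0 < p.2 + h ->
  {for p, continuous (fun q : V => gauss b kp kk h z (q.1 0 i) q.2)}.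
Proof.
move=> ph.
have cx : (fun q : V => q.1 0 i) @ p --> p.1 0 i by exact: continuous_fst_coord.
have ct : (fun q : V => q.2) @ p --> p.2 by exact: cvg_snd.
have cth : (fun q : V => q.2 + h) @ p --> p.2 + h.
  by apply: cvgD => //; exact: cvg_cst.
apply: continuous_cvg; first exact: continuous_expR.
rewrite /gauss_log; apply: cvgB; first apply: cvgB.
- apply: cvgD; first exact: cvg_cst.
  by apply: cvgM => //; exact: cvg_cst.
- apply: cvgM; first exact: cvg_cst.
  by apply: continuous_cvg cth; exact: continuous_ln.
- apply: cvgM; last by apply: cvgV => //; rewrite gt_eqF.
  apply: cvgM; first exact: cvg_cst.
  rewrite expr2; under eq_fun do rewrite expr2.
  by apply: cvgM; apply: cvgB => //; exact: cvg_cst.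
Qed.

Lemma cvg_sum_ord T (F : set_system T) {FF : Filter F} m (f : 'I_m -> T -> R)
    (l : 'I_m -> R) : (forall i, f i @ F --> l i) ->
  \sum_(i < m) f i x @[x --> F] --> \sum_(i < m) l i.
Proof.
elim: m f l => [|m IH] f l fl.
  rewrite big_ord0; under eq_fun do rewrite big_ord0.
  exact: cvg_cst.
rewrite big_ord_recl; under eq_fun do rewrite big_ord_recl.
by apply: cvgD => //; exact: IH.
Qed.

Lemma continuous_barrier (p : V) : 0 < p.2 -> (forall k, 0 < th k) ->
  {for p, continuous barrier}.
Proof.
move=> p0 th0.
have cx i : (fun q : V => q.1 0 i) @ p --> p.1 0 i by exact: continuous_fst_coord.
rewrite /barrier /separable_sum.
apply: cvg_sum_ord => i; apply: cvgD.
  apply: cvgM; first exact: cvg_cst.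
  rewrite expr2; under eq_fun do rewrite expr2.
  by apply: cvgM; apply: cvgB => //; exact: cvg_cst.
case: eqP => _; last exact: cvg_cst.
apply: cvgD; apply: cvgM; try exact: cvg_cst.
  apply: (@cvg_comp _ _ _ (fun q : V => q.2) (fun r : R => r `^ (1 - tau))).
    exact: cvg_snd.
  have [dpow _] := is_derive1_powR (1 - tau) p0.
  by have /derivable1_diffP/differentiable_continuous := dpow.
by apply: cvg_sum_ord => k; apply: continuous_gauss; rewrite addr_gt0.
Qed.

End Barrier.

(** * Bounds on the barrier *)

Section BarrierBounds.
Variables (R : realType) (n : nat) (i0 : 'I_n).
Variables (a kap K A G tau C : R) (y0 : 'rV[R]_n).
Variables (y : nat -> R) (th : nat -> R) (N : nat).
Hypotheses (a0 : 0 <= a) (kap0 : 0 <= kap) (K0 : 0 <= K).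
Hypotheses (A0 : 0 <= A) (G0 : 0 <= G) (C0 : 0 <= C) (th0 : forall k, 0 < th k).
Local Notation V := ('rV[R]_n * R)%type.
Implicit Types (p : V) (x t : R).

Local Notation S := (singular_part a kap K G tau C y th N).
Local Notation Psi := (barrier i0 a kap K A G tau C y0 y th N).

Lemma singular_part_ge_gauss (k : 'I_N) x t :
  C * gauss a kap K (th k) (y k) x t <= S x t.
Proof.
rewrite /singular_part ler_wpDl ?mulr_ge0 ?powR_ge0// ler_wpM2l//.
by rewrite (bigD1 k)//= lerDl sumr_ge0// => j _; exact: expR_ge0.
Qed.

Lemma singular_part_ge0 x t : 0 <= S x t.
Proof.
rewrite addr_ge0 ?mulr_ge0 ?powR_ge0//.
by apply: sumr_ge0 => j _; exact: expR_ge0.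
Qed.

Lemma profile_ge0 i x t : 0 <= profile i0 a kap K A G tau C y0 y th N i x t.
Proof.
rewrite /profile; apply: addr_ge0; first by apply: mulr_ge0 => //; exact: sqr_ge0.
by case: (i == i0) => //; exact: singular_part_ge0.
Qed.

Lemma barrier_ge_profile p i :
  profile i0 a kap K A G tau C y0 y th N i (p.1 0 i) p.2 <= Psi p.
Proof.
rewrite /barrier /separable_sum (bigD1 i)//= lerDl sumr_ge0// => j _.
exact: profile_ge0.
Qed.

Lemma barrier_ge0 p : 0 <= Psi p.
Proof. by apply: sumr_ge0 => i _; exact: profile_ge0. Qed.

Lemma barrier_ge_sqr p i : A * (p.1 0 i - y0 0 i) ^+ 2 <= Psi p.
Proof.
apply: le_trans (barrier_ge_profile p i); rewrite lerDl.
by case: (i == i0) => //; exact: singular_part_ge0.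
Qed.

Lemma barrier_ge_gauss p (k : 'I_N) :
  C * gauss a kap K (th k) (y k) (p.1 0 i0) p.2 <= Psi p.
Proof.
apply: le_trans (barrier_ge_profile p i0); rewrite /profile eqxx.
rewrite ler_wpDl ?singular_part_ge_gauss//; apply: mulr_ge0 => //; exact: sqr_ge0.
Qed.

Lemma barrier_le p : 0 < p.2 <= 1 ->
  Psi p <= A * (\sum_(i < n) (p.1 0 i - y0 0 i) ^+ 2)
    + G * p.2 `^ (1 - tau)
    + C * (expR (K - a * ln p.2) * \sum_(k < N) th k `^ a).
Proof.
move=> p2; rewrite /barrier /separable_sum big_split /= -mulr_sumr.
rewrite -addrA lerD2l -big_mkcond big_pred1_eq lerD2l ler_wpM2l//.
rewrite mulr_sumr ler_sum// => k _.
rewrite /powR gt_eqF// mulrC; exact: gauss_le.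
Qed.

End BarrierBounds.

(** The Gaussians and G t^(1-tau) are handled separately from the quadratic
    term, which costs at most A (2 lam + 2 B r) in each coordinate as long as
    the point stays in the cube of half-width r. *)
Lemma barrier_supersolution (R : realType) (n : nat) (i0 : 'I_n)
    (lam s B A G tau C r : R) (y0 : 'rV[R]_n) (y th : nat -> R) (N : nat)
    (beta : 'I_n -> R) (p : 'rV[R]_n * R) :
  let kap := s / (4 * lam) in let K := kap * B ^+ 2 / (1 - s) in
  0 < lam -> 0 < s < 1 -> 0 <= A -> 0 <= C ->
  (forall i, `|beta i| <= B) -> (forall i, `|p.1 0 i - y0 0 i| <= r) ->
  G * ((1 - tau) * p.2 `^ (- tau)) - n%:R * (A * (2 * lam + 2 * B * r)) <=
  \sum_(i < n) (profile_t i0 (s / 2) kap K G tau C y th N i (p.1 0 i) p.2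
    - lam * profile_xx i0 (s / 2) kap K A C y th N i (p.1 0 i) p.2
    - beta i * profile_x i0 (s / 2) kap K A C y0 y th N i (p.1 0 i) p.2).
Proof.
move=> kap K lam0 s01 A0 C0 betaB pr.
pose d : R := G * ((1 - tau) * p.2 `^ (- tau)).
have -> : G * ((1 - tau) * p.2 `^ (- tau)) - n%:R * (A * (2 * lam + 2 * B * r)) =
    \sum_(i < n) ((if i == i0 then d else 0) - A * (2 * lam + 2 * B * r)).
  by rewrite sumrB -big_mkcond big_pred1_eq sumr_const card_ord mulr_natl.
apply: ler_sum => i _; rewrite /profile_t /profile_xx /profile_x.
have quad : beta i * (A * (2 * (p.1 0 i - y0 0 i))) <= A * (2 * B * r).
  have -> : beta i * (A * (2 * (p.1 0 i - y0 0 i))) =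
    A * (2 * (beta i * (p.1 0 i - y0 0 i))) by ring.
  rewrite ler_wpM2l// -mulrA ler_wpM2l// (le_trans (ler_norm _))// normrM.
  by rewrite ler_pM.
case: (i == i0); last by lra.
rewrite /singular_part_t /singular_part_xx /singular_part_x -/d.
set S1 := \sum_(k < N) _; set S2 := \sum_(k < N) _; set S3 := \sum_(k < N) _.
have : 0 <= C * (S1 - lam * S2 - beta i * S3).
  rewrite mulr_ge0// /S1 /S2 /S3 !mulr_sumr -!sumrB; apply: sumr_ge0 => k _.
  exact: gauss_supersolution.
by lra.
Qed.

(** * The lower bound near the initial point *)

Section LowerBound.
Variables (R : realType) (n : nat) (i0 : 'I_n).
Local Notation V := ('rV[R]_n * R)%type.

Lemma compact_cube (y0 : 'rV[R]_n) (r t : R) :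
  compact [set q : V | (forall i, `|q.1 0 i - y0 0 i| <= r) /\ 0 <= q.2 <= t].
Proof.
have -> : [set q : V | (forall i, `|q.1 0 i - y0 0 i| <= r) /\ 0 <= q.2 <= t] =
    [set x : 'rV[R]_n | forall i, `[y0 0 i - r, y0 0 i + r]%classic (x 0 i)]
    `*` `[0, t]%classic.
  apply/seteqP; split=> -[x t'] /= [xr tt].
    by split=> [i|]; rewrite in_itv//= -ler_distl.
  by split=> [i|]; [have := xr i; rewrite in_itv /= -ler_distl|
                    move: tt; rewrite in_itv].
apply: compact_setX; last exact: segment_compact.
exact: (@rV_compact R n (fun i => `[y0 0 i - r, y0 0 i + r]%classic)
  (fun i => @segment_compact R (y0 0 i - r) (y0 0 i + r))).
Qed.

Lemma open_cylinder (Omega : set 'rV[R]_n) (T : R) :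
  open Omega -> open (cylinder Omega T).
Proof.
move=> oO; rewrite openE => -[x t] [/= Ox tT]; exists (Omega, `]0, T[%classic) => //.
by split=> /=; apply: open_nbhs_nbhs; split=> //; exact: interval_open.
Qed.

Lemma near_not_closure (A : set V) q : ~ closure A q -> \forall q' \near q, ~ A q'.
Proof.
move=> nA; have : nbhs q (~` closure A).
  by apply: open_nbhs_nbhs; split=> //; apply: closed_openC; exact: closed_closure.
by apply: filterS => q' nAq' Aq'; apply: nAq'; exact: subset_closure.
Qed.

Variables (lam Lam T : R) (Omega : set 'rV[R]_n).
Variables (b : V -> 'rV[R]_n) (c : V -> R) (E : set 'rV[R]_n) (s : R).
Variables (y0 : 'rV[R]_n) (u : V -> R) (L tau B r : R).
Local Notation Q := (cylinder Omega T).

Hypotheses (lam0 : 0 < lam) (lamLam : lam <= Lam) (oOmega : open Omega).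
Hypotheses (s01 : 0 < s < 1) (Es : hausdorff_measure s E = 0%E).
Hypotheses (uQ : C21 Q u) (L0 : 0 < L) (tau01 : 0 < tau < 1) (r0 : 0 < r).
Hypothesis B0 : 0 <= B.
Hypothesis bB : forall p, Q p -> forall i, `|b p 0 i| <= B.
Hypothesis c0 : forall p, Q p -> c p <= 0.
Hypothesis uL : forall p, Q p -> - L <= u p.
Hypothesis uf : forall p, Q p -> parabolic_op lam Lam b c u p <= L * p.2 `^ (- tau).
Hypothesis ubd : forall q, boundary Q q -> ~ (E `*` [set 0]) q ->
  (forall i, `|q.1 0 i - y0 0 i| <= r) -> 0 <= q.2 <= r -> nonneg_at Q u q.

(* A makes the quadratic term reach L outside the cube of half-width r; G makes
   G (1 - tau) t^(-tau) exceed L t^(-tau) plus the cost of the quadratic term by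
   at least 1 when t <= 1; C turns the lower bound of the Gaussians into L. *)
Let kap := s / (4 * lam).
Let K := kap * B ^+ 2 / (1 - s).
Let A := L / r ^+ 2.
Let G := (L + n%:R * (A * (2 * lam + 2 * B * r)) + 1) / (1 - tau).
Let C := L * expR (s / 2 * ln 2 + 4 * kap).

Let kap0 : 0 < kap. Proof. by have /andP[? _] := s01; rewrite divr_gt0// mulr_gt0. Qed.
Let K0 : 0 <= K.
Proof.
have /andP[_ s1] := s01; apply: divr_ge0; last by rewrite subr_ge0 ltW.
by apply: mulr_ge0; [exact: ltW|exact: sqr_ge0].
Qed.
Let A0 : 0 <= A. Proof. by rewrite divr_ge0 ?sqr_ge0// ltW. Qed.
Let C0 : 0 <= C. Proof. by rewrite mulr_ge0 ?expR_ge0// ltW. Qed.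
Let s20 : 0 <= s / 2. Proof. by have /andP[? _] := s01; rewrite divr_ge0 ?ltW. Qed.

Let D0 : 0 <= n%:R * (A * (2 * lam + 2 * B * r)).
Proof.
apply: mulr_ge0 => //; apply: mulr_ge0 => //.
by apply: addr_ge0; rewrite ?mulr_ge0// ltW.
Qed.
Let G0 : 0 <= G.
Proof.
have /andP[_ tau1] := tau01; apply: divr_ge0; last by rewrite subr_ge0 ltW.
by rewrite addr_ge0// addr_ge0// ltW.
Qed.

Let Psi (y : nat -> 'rV[R]_n) (th : nat -> R) (N : nat) : V -> R :=
  barrier i0 (s / 2) kap K A G tau C y0 (fun k => y k 0 i0) th N.

(** At such a minimum the operator applied to u is at least
    G (1 - tau) t^(-tau) minus the cost of the quadratic term, which by the
    choice of G is larger than the right-hand side L t^(-tau). *)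
Lemma no_negative_min (y : nat -> 'rV[R]_n) (th : nat -> R) N p :
    (forall k, 0 < th k) -> Q p -> p.2 <= 1 ->
    (forall i, `|p.1 0 i - y0 0 i| <= r) -> u p <= 0 ->
    ~ (forall q, Q q -> q.2 <= p.2 -> u p + Psi y th N p <= u q + Psi y th N q).
Proof.
move=> th0 Qp p1 pr up0 pmin.
have p0 : 0 < p.2 by case: Qp => _; rewrite /= in_itv /= => /andP[].
have oQ := open_cylinder (T := T) oOmega.
have near_min : \forall q \near p, q.2 <= p.2 ->
    u p + Psi y th N p <= u q + Psi y th N q.
  have : \forall q \near p, Q q by exact: oQ.
  by apply: filterS => q; exact: pmin.
have cu0 : 0 <= c p * u p by rewrite mulr_le0 ?c0.
have lamL : 0 <= lam <= Lam by rewrite ltW.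
have := parabolic_op_ge_at_min b oQ uQ Qp lamL cu0
  (fun i x => is_derive_profile_x i0 (s / 2) kap K A G tau C y0
     (fun k => y k 0 i0) th N i x p.2)
  (fun i x => is_derive_profile_xx i0 (s / 2) kap K A C y0
     (fun k => y k 0 i0) th N i x p.2)
  (fun i x => is_derive_profile_t i0 (s / 2) kap K A G tau C y0
     (fun k => y k 0 i0) N i x p0 th0) near_min.
move=> /le_trans/(_ (uf Qp)).
have := @barrier_supersolution R n i0 lam s B A G tau C r y0
  (fun k => y k 0 i0) th N (b p 0) p lam0 s01 A0 C0 (bB Qp) pr.
move=> /le_trans super /super {super}.
have /andP[tau0 tau1] := tau01.
have tau1' : 0 < 1 - tau by rewrite subr_gt0.
have X1 : 1 <= p.2 `^ (- tau).
  rewrite -(powRr0 p.2); apply: ger_powR; first by rewrite p0.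
  by rewrite oppr_le0 ltW.
have -> : G * ((1 - tau) * p.2 `^ (- tau)) =
    (L + n%:R * (A * (2 * lam + 2 * B * r)) + 1) * p.2 `^ (- tau).
  by rewrite [LHS]mulrA /G divfK// gt_eqF.
have : 0 <= n%:R * (A * (2 * lam + 2 * B * r)).
  exact: D0.
have contra (X D : R) : 1 <= X -> 0 <= D -> (L + D + 1) * X - D <= L * X -> False.
  by move=> *; nra.
exact: contra.
Qed.

(** Near a point of E x {0} a single Gaussian already lifts u above 0, and near
    the other points u itself is almost nonnegative.  Adding more Gaussians
    only increases the barrier, so compactness of the part of the cube outside
    the domain yields one N for all of its points. *)
Lemma near_parabolic_boundary (y : nat -> 'rV[R]_n) (th : nat -> R) (t m : R) :
    (forall k, 0 < th k) -> t <= r -> m < 0 ->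
    (forall x, E x -> exists k, forall i, (x 0 i - y k 0 i) ^+ 2 <= th k) ->
  exists N, forall q : V, (forall i, `|q.1 0 i - y0 0 i| <= r) -> 0 <= q.2 <= t ->
    ~ Q q -> \forall q' \near q, Q q' -> m < u q' + Psi y th N q'.
Proof.
move=> th0 tr m0 Ecov.
pose Z := [set q : V | (forall i, `|q.1 0 i - y0 0 i| <= r) /\ 0 <= q.2 <= t]
  `&` ~` Q.
have cK := @compact_cube y0 r t.
have cZ : compact Z.
  apply: (subclosed_compact _ cK); last by move=> q [].
  apply: closedI; last exact/open_closedC/open_cylinder.
  by apply: compact_closed cK; exact: norm_hausdorff.
have local q : Z q -> exists k, \forall q' \near q,
    forall N, (k <= N)%N -> Q q' -> m < u q' + Psi y th N q'.
  move=> [[qr /andP[q0 qt]] nQ].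
  have [/=|nEq] := pselect ((E `*` [set 0]) q).
    move=> [/Ecov[k Fk] q20]; exists k.+1.
    have near1 : nbhs q [set q' : V | (q'.1 0 i0 - y k 0 i0) ^+ 2 < 4 * th k].
      have cx : (fun q' : V => (q'.1 0 i0 - y k 0 i0) ^+ 2) @ q -->
          (q.1 0 i0 - y k 0 i0) ^+ 2.
        rewrite expr2; under eq_fun do rewrite expr2.
        by apply: cvgM; apply: cvgB; try exact: cvg_cst; exact: continuous_fst_coord.
      by apply: (cvgr_lt _ cx); have := Fk i0; have := th0 k; lra.
    have near2 : nbhs q [set q' : V | q'.2 < th k].
      have ct : (fun q' : V => q'.2) @ q --> q.2 by exact: cvg_snd.
      by apply: (cvgr_lt _ ct); rewrite q20.
    apply: filterS2 near1 near2 => q' xq tq N kN Qq'.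
    have t0 : 0 <= q'.2 by case: Qq' => _; rewrite /= in_itv /= => /andP[/ltW].
    have tq' : 0 <= q'.2 <= th k by rewrite t0 ltW.
    have := gauss_ge s20 (ltW kap0) K0 (th0 k) tq' (ltW xq).
    move=> /(ler_wpM2l C0); rewrite {1}/C expRN mulfK ?expR_eq0// => Lgauss.
    have /(le_trans Lgauss) LPsi := barrier_ge_gauss i0 (s / 2) kap K tau y0
      (fun k => y k 0 i0) th A0 G0 C0 q' (Ordinal kN).
    by apply: lt_le_trans m0 _; have := uL Qq'; rewrite /Psi; lra.
  exists 0%N.
  have nearu : \forall q' \near q, Q q' -> m < u q'.
    have [clq|/near_not_closure] := pselect (closure Q q); last first.
      by apply: filterS => q' nQq' /nQq'.
    have bq : boundary Q q by split=> // /interior_subset.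
    have qr' : 0 <= q.2 <= r by rewrite q0 (le_trans qt).
    have /nonneg_atP/(_ (- m)) := ubd bq nEq qr qr'.
    by rewrite oppr_gt0 opprK; apply.
  apply: filterS nearu => q' uq' N _ /uq'{}uq'.
  by rewrite (lt_le_trans uq')// lerDl; exact: barrier_ge0.
have cover : \forall N \near \oo, Z `<=` (fun q => \forall q' \near q, Q q' ->
    m < u q' + Psi y th N q').
  apply: ((compact_near_coveringP Z).1 cZ) => q /local[k near_q].
  (* A neighbourhood of q contains a neighbourhood of each point of its interior,
     so the local statement at q passes to the nearby points. *)
  exists ((fun q' => \forall q'' \near q', forall N, (k <= N)%N -> Q q'' ->
            m < u q'' + Psi y th N q''), [set N | (k <= N)%N]).
    by split; [exact: nbhs_interior|exists k].
  by move=> [q' N] /= [near_q' kN]; apply: filterS near_q' => q'' /(_ N kN).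
have [N _ /(_ N (leqnn N)) ZN] := cover.
by exists N => q qr qt nQ; apply: ZN.
Qed.

(** The constants A and G do not depend on the cover of E: for a given point p, the
    total contribution of the Gaussians at p is made smaller than the assumed
    defect by choosing the cover of E fine enough. *)
Lemma supersolution_lower_bound : exists A G : R, forall p, Q p ->
    (forall i, `|p.1 0 i - y0 0 i| <= r) -> p.2 <= r -> p.2 <= 1 ->
  0 <= u p + (A * (\sum_(i < n) (p.1 0 i - y0 0 i) ^+ 2) + G * p.2 `^ (1 - tau)).
Proof.
exists A, G => p Qp pr p2r p21; rewrite leNgt; apply/negP.
set Phi := A * _ + _ => neg.
pose m := (u p + Phi) / 2.
have m0 : m < 0 by rewrite /m; lra.
have p20 : 0 < p.2 by case: Qp => _; rewrite /= in_itv /= => /andP[].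
have p201 : 0 < p.2 <= 1 by rewrite p20.
pose D := C * expR (K - s / 2 * ln p.2).
have Dpos : 0 < D by rewrite !mulr_gt0 ?expR_gt0.
have e0 : 0 < - m / D by rewrite divr_gt0// oppr_gt0.
have /andP[s0 _] := s01.
have [y [th [th0 sum_th Ecov]]] := hausdorff_measure0_cubes s0 Es e0.
have [N Nbd] := near_parabolic_boundary th0 p2r m0 Ecov.
pose v q := u q + Psi y th N q.
have Psi_le : Psi y th N p <= Phi - m.
  have := barrier_le i0 (kap := kap) (K := K) A G tau y0 (fun k => y k 0 i0) N
    s20 (ltW kap0) K0 C0 th0 p201.
  move=> /le_trans; apply; rewrite /Phi lerD2l mulrA -/D -ler_pdivlMl//.
  by rewrite [leRHS]mulrC; exact: sum_th.
have vp : v p <= m by move: Psi_le; rewrite /v /m; lra.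
have cK := @compact_cube y0 r p.2.
have clK := compact_closed (@norm_hausdorff _ _) cK.
have vcont q : Q q -> {for q, continuous v}.
  move=> Qq; have q0 : 0 < q.2 by case: Qq => _; rewrite /= in_itv /= => /andP[].
  apply: cvgD; first by have [+ _ _ _] := uQ; exact.
  exact: continuous_barrier.
have Kp : (forall i, `|p.1 0 i - y0 0 i| <= r) /\ 0 <= p.2 <= p.2.
  by rewrite lexx ltW.
(* Only times up to that of p are considered, so the minimum may be attained at
   the final time. *)
have [//|p' [Qp' [p'r /andP[p'0 p'2]] vp' pmin]] := exists_min_sublevel
  (open_cylinder (T := T) oOmega) clK cK vcont _ Qp Kp vp.
  by move=> q [qr q2] nQ; exact: Nbd.
have Psi0 q : 0 <= Psi y th N q by exact: barrier_ge0.
apply: (no_negative_min (y := y) (N := N) th0 Qp' (le_trans p'2 p21) p'r).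
  by have := Psi0 p'; move: vp'; rewrite /v; lra.
move=> q Qq q2.
have q0 : 0 <= q.2 by case: Qq => _; rewrite /= in_itv /= => /andP[/ltW].
have [qr|/existsNP[i /negP]] := pselect (forall i, `|q.1 0 i - y0 0 i| <= r).
  by apply: pmin => //; split=> //; rewrite q0 (le_trans q2).
rewrite -ltNge => far; apply: (le_trans vp'); apply: (le_trans (ltW m0)).
have r2 : r ^+ 2 <= (q.1 0 i - y0 0 i) ^+ 2.
  by rewrite -(real_normK (num_real (_ - _))) lerXn2r ?nnegrE// ltW.
have : L <= Psi y th N q.
  apply: le_trans (barrier_ge_sqr i0 (s / 2) kap K tau y0 _ th N A0 G0 C0 q i).
  have -> : L = A * r ^+ 2 by rewrite /A divfK// gt_eqF// exprn_gt0.
  by rewrite ler_wpM2l.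
by have := uL Qq; lra.
Qed.

End LowerBound.

(** * The theorem *)

Lemma coord_le_enorm (R : realType) (n : nat) (x : 'rV[R]_n) (i : 'I_n) :
  `|x 0 i| <= enorm x.
Proof.
rewrite -ler_sqr ?nnegrE ?normr_ge0 ?sqrtr_ge0// real_normK ?num_real//.
exact: sqr_coord_le_enorm.
Qed.

Lemma near_cube (R : realType) (n : nat) (y0 : 'rV[R]_n) (r : R) : 0 < r ->
  nbhs (y0, 0 : R) [set q : 'rV[R]_n * R |
    (forall i, `|q.1 0 i - y0 0 i| <= r) /\ q.2 <= r].
Proof.
move=> r0; apply/nbhs_ballP; exists r => // -[x t] /= [[_ yx] rt].
split=> [i|]; last first.
  by move: rt; rewrite /ball /= sub0r normrN => /ltr_normlW/ltW.
by have := yx ord0 i; rewrite /ball /= distrC => /ltW.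
Qed.

Lemma barrier_vanishes (R : realType) (n : nat) (y0 : 'rV[R]_n) (A G tau e : R) :
  tau < 1 -> 0 < e ->
  nbhs (y0, 0 : R) [set q : 'rV[R]_n * R | 0 < q.2 ->
    A * (\sum_(i < n) (q.1 0 i - y0 0 i) ^+ 2) + G * q.2 `^ (1 - tau) < e].
Proof.
move=> tau1 e0; have e2 : 0 < e / 2 by rewrite divr_gt0.
have tau1' : 0 < 1 - tau by rewrite subr_gt0.
have c1 : (fun q : 'rV[R]_n * R => A * (\sum_(i < n) (q.1 0 i - y0 0 i) ^+ 2))
    @ (y0, 0 : R) --> A * (\sum_(i < n) ((y0, 0 : R).1 0 i - y0 0 i) ^+ 2).
  apply: cvgM; first exact: cvg_cst.
  apply: cvg_sum_ord => i; rewrite expr2; under eq_fun do rewrite expr2.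
  by apply: cvgM; apply: cvgB; try exact: cvg_cst; exact: continuous_fst_coord.
have near1 : nbhs (y0, 0 : R) [set q : 'rV[R]_n * R |
    A * (\sum_(i < n) (q.1 0 i - y0 0 i) ^+ 2) < e / 2].
  apply: (cvgr_lt _ c1); rewrite big1 ?mulr0//= => i _.
  by rewrite subrr expr0n.
have near2 : nbhs (y0, 0 : R) [set q : 'rV[R]_n * R |
    0 < q.2 -> G * q.2 `^ (1 - tau) < e / 2].
  have c2 : G * t `^ (1 - tau) @[t --> (0 : R)^'+] --> G * 0.
    by apply: cvgM; [exact: cvg_cst|exact: powR_cvg0].
  rewrite mulr0 in c2; have := cvgr_lt _ c2 _ e2; rewrite near_withinE.
  move=> /(_ (at_right_proper_filter 0)) near_t.
  have c3 : (fun q : 'rV[R]_n * R => q.2) @ (y0, 0 : R) --> (0 : R) by exact: cvg_snd.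
  exact: (c3 (fun t => 0 < t -> G * t `^ (1 - tau) < e / 2) near_t).
apply: filterS2 near1 near2 => q q1 q2 /q2{}q2.
by rewrite [e]splitr ltrD.
Qed.

Unset Implicit Arguments.

Theorem theorem4p1 (R : realType) (n : nat) (hn : (1 <= n)%N)
    (lam Lam T : R) (hlam : 0 < lam) (hlL : lam < Lam) (hT : 0 < T)
    (Omega : set 'rV[R]_n) (hOmega : open Omega)
    (b : 'rV[R]_n * R -> 'rV[R]_n) (c : 'rV[R]_n * R -> R)
    (hb : exists K : R, forall p, cylinder Omega T p -> enorm (b p) <= K)
    (hc : exists K : R, forall p, cylinder Omega T p -> `|c p| <= K)
    (hc0 : forall p, cylinder Omega T p -> c p <= 0)
    (beta : R) (hbeta : 0 < beta < 1)
    (b0 c0 : R -> R)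
    (b0_ge0 : forall t, 0 < t < T -> 0 <= b0 t)
    (c0_ge0 : forall t, 0 < t < T -> 0 <= c0 t)
    (hbb0 : forall x t, cylinder Omega T (x, t) -> enorm (b (x, t)) <= b0 t)
    (hcc0 : forall x t, cylinder Omega T (x, t) -> `|c (x, t)| <= c0 t)
    (b0_o : b0 =o_ (0^'+) (fun t : R => t `^ (- (1 / 2))))
    (c0_o : c0 =o_ (0^'+) (fun t : R => t `^ (1 - beta)))
    (E : set 'rV[R]_n) (hE : E `<=` closure Omega)
    (hdimE : (hausdorff_dim E < (lam / Lam)%:E)%E)
    (y0 : 'rV[R]_n) (hy0 : E y0)
    (u : 'rV[R]_n * R -> R) (hu : C21 (cylinder Omega T) u)
    (L tau : R) (hL : 0 < L) (htau : 0 < tau < beta)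
    (u_lb : forall x t, cylinder Omega T (x, t) -> - L <= u (x, t))
    (u_super : forall x t, cylinder Omega T (x, t) ->
       parabolic_op lam Lam b c u (x, t) <= L * t `^ (- tau))
    (u_bd : nonneg_on_near (cylinder Omega T) u
              (boundary (cylinder Omega T) `\` (E `*` [set 0])) (y0, 0)) :
  nonneg_at (cylinder Omega T) u (y0, 0).
Proof.
have lL : 0 < Lam by exact: lt_trans hlL.
have [s [/andP[s0 sd] Es]] := hausdorff_dim_lt hdimE.
have s01 : 0 < s < 1.
  by rewrite s0 (lt_trans sd)// ltr_pdivrMr// mul1r.
have /andP[tau0 taub] := htau; have /andP[_ beta1] := hbeta.
have tau01 : 0 < tau < 1 by rewrite tau0 (lt_trans taub).
have [B bB] := hb.
have bB' p : cylinder Omega T p -> forall i, `|b p 0 i| <= `|B|.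
  move=> Qp i; apply: le_trans (coord_le_enorm _ _) _.
  by apply: le_trans (bB p Qp) _; exact: ler_norm.
have := u_bd; rewrite /nonneg_on_near => /nbhs_ballP[d /= d0 ubd].
have r0 : 0 < d / 2 by rewrite divr_gt0.
have ubd' q : boundary (cylinder Omega T) q -> ~ (E `*` [set 0]) q ->
    (forall i, `|q.1 0 i - y0 0 i| <= d / 2) -> 0 <= q.2 <= d / 2 ->
    nonneg_at (cylinder Omega T) u q.
  move=> bq nEq qr /andP[q0 qd]; apply: ubd => //; split.
    split=> // i j; rewrite ord1 /ball /= distrC (le_lt_trans (qr j))//.
    by rewrite ltr_pdivrMr//; lra.
  rewrite /ball /= sub0r normrN ger0_norm// (le_lt_trans qd)//; lra.
have uL p : cylinder Omega T p -> - L <= u p by case: p; exact: u_lb.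
have uf p : cylinder Omega T p ->
  parabolic_op lam Lam b c u p <= L * p.2 `^ (- tau) by case: p; exact: u_super.
have [A [G lower]] := supersolution_lower_bound (Ordinal hn) hlam (ltW hlL)
  hOmega s01 Es hu hL tau01 r0 (normr_ge0 B) bB' hc0 uL uf ubd'.
have /andP[_ tau1] := tau01.
apply/nonneg_atP => e e0.
have r10 : 0 < Num.min (d / 2) 1 by rewrite lt_min r0 ltr01.
apply: filterS2 (near_cube y0 r10) (barrier_vanishes y0 A G tau1 e0) => q.
move=> [qr]; rewrite le_min => /andP[q2r q21] small Qq.
have q20 : 0 < q.2 by case: Qq => _; rewrite /= in_itv /= => /andP[].
have qr' i : `|q.1 0 i - y0 0 i| <= d / 2.
  by have := qr i; rewrite le_min => /andP[].
by have := lower q Qq qr' q2r q21; have := small q20; lra.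
Qed.
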